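(* Let $\Omega$ be a sample space, let $\mathcal{C}\subset\mathcal{P}(\Omega)$ be a field on $\Omega$, and let $P:\mathcal{C}\to\mathbb{R}$ be a price assignment. Then $P$ is system-2-coherent if and only if $P$ is a countably additive probability.
   Context: $\mathcal{C}$ is the set of events for which prices are assigned; a price assignment is a function $P:\mathcal{C}\to\mathbb{R}$. $I_A$ denotes the indicator function of $A\subset\Omega$, and $\mathbb{Z}^{+}=\{1,2,3,\ldots\}$. A betting portfolio is a sequence $(\alpha_i,A_i)_{i\in\mathbb{Z}^{+}}$ with $\alpha_i\in\mathbb{R}$ and $A_i\in\mathcal{C}$. Its price is $\sum_{i=1}^{\infty}\alpha_iP(A_i)$ and its balance is $\sum_{i=1}^{\infty}\alpha_i(I_{A_i}-P(A_i))$. A betting system is a collection of betting portfolios. Betting system 2 (for given $(\Omega,\mathcal{C},P)$) consists of exactly those betting portfolios $(\alpha_i,A_i)_{i\in\mathbb{Z}^{+}}$ such that $\sum_{i=1}^{\infty}|\alpha_i|P(A_i)<\infty$ and $\sum_{i=1}^{\infty}\alpha_i(I_{A_i}-P(A_i))$ converges pointwise on $\Omega$. $P$ is incoherent in a given betting system if there exist a betting portfolio $(\alpha_i,A_i)_{i\in\mathbb{Z}^{+}}$ in that system and $\epsilon>0$ such that for all $w\in\Omega$, $\sum_{i=1}^{\infty}\alpha_i(I_{A_i}(w)-P(A_i))\le-\epsilon$. $P$ is coherent in the system if it is not incoherent in it; system-2-coherent means coherent in betting system 2. For a field $\mathcal{C}$, $P$ is a finitely additive probability if $0\le P(A)\le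 1$ for all $A\in\mathcal{C}$, $P(\Omega)=1$, and $P(A\cup B)=P(A)+P(B)$ for all disjoint $A,B\in\mathcal{C}$. $P$ is a countably additive probability if in addition, for every sequence $(A_i)_{i\ge1}$ of disjoint sets in $\mathcal{C}$ with $\bigcup_{i\ge1}A_i\in\mathcal{C}$, $P(\bigcup_{i\ge1}A_i)=\sum_{i=1}^{\infty}P(A_i)$. *)

(* Defs.v *)
From mathcomp Require Import all_boot all_order all_algebra.
From mathcomp Require Import all_classical all_reals all_analysis.

Set Implicit Arguments.
Unset Strict Implicit.
Unset Printing Implicit Defensive.

Import Order.TTheory GRing.Theory Num.Theory.
Import numFieldNormedType.Exports.

Local Open Scope classical_set_scope.
Local Open Scope ring_scope.

(* The sample space is a whole type [Omega].  A price assignment on [C] is a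
   total function [set Omega -> R]; every definition below consults it only at
   members of [C], so its values outside [C] are irrelevant.  Sequences indexed
   by the positive integers are re-indexed by [nat], starting from 0. *)

Definition field_of_sets (Omega : Type) (C : set (set Omega)) : Prop :=
  [/\ C setT, setC_closed C & setU_closed C].

(* A sequence of pairs (stake, event). *)
Definition bets (R : realType) (Omega : Type) : Type :=
  (R * set Omega)%type ^nat.

Definition betting_portfolio (R : realType) (Omega : Type)
    (C : set (set Omega)) : set (bets R Omega) :=
  [set b | forall i, C (b i).2].

Definition balance_term (R : realType) (Omega : Type)
    (P : set Omega -> R) (b : bets R Omega) (w : Omega) : R ^nat :=
  fun i => (b i).1 * (\1_((b i).2) w - P (b i).2).

(* Only meaningful where the series converges, which [betting_system2]
   guarantees at every [w]. *)
Definition balance (R : realType) (Omega : Type)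
    (P : set Omega -> R) (b : bets R Omega) (w : Omega) : R :=
  limn (series (balance_term P b w)).

(* Prices may be negative a priori, so "the sum of |alpha_i| P(A_i) is finite"
   is read as convergence of the series to a real number. *)
Definition betting_system2 (R : realType) (Omega : Type)
    (C : set (set Omega)) (P : set Omega -> R) : set (bets R Omega) :=
  [set b | [/\ betting_portfolio C b,
      cvgn (series (fun i => `|(b i).1| * P (b i).2)) &
      forall w, cvgn (series (balance_term P b w))]].

Definition incoherent (R : realType) (Omega : Type)
    (S : set (bets R Omega)) (P : set Omega -> R) : Prop :=
  exists b, exists eps : R,
    [/\ S b, 0 < eps & forall w, balance P b w <= - eps].

Definition coherent (R : realType) (Omega : Type)
    (S : set (bets R Omega)) (P : set Omega -> R) : Prop :=
  ~ incoherent S P.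

Definition system2_coherent (R : realType) (Omega : Type)
    (C : set (set Omega)) (P : set Omega -> R) : Prop :=
  coherent (betting_system2 C P) P.

Definition finitely_additive_probability (R : realType) (Omega : Type)
    (C : set (set Omega)) (P : set Omega -> R) : Prop :=
  [/\ forall A, C A -> 0 <= P A <= 1,
      P setT = 1 &
      forall A B, C A -> C B -> A `&` B = set0 -> P (A `|` B) = P A + P B].

Definition countably_additive_probability (R : realType) (Omega : Type)
    (C : set (set Omega)) (P : set Omega -> R) : Prop :=
  finitely_additive_probability C P /\
  forall A : (set Omega) ^nat,
    (forall i, C (A i)) -> trivIset setT A -> C (\bigcup_i A i) ->
    series (fun i => P (A i)) @ \oo --> P (\bigcup_i A i).

(* Main.v *)
Require Import Defs.
From mathcomp Require Import all_boot all_order all_algebra.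
From mathcomp Require Import all_classical all_reals all_analysis.
From mathcomp Require Import ring lra.

(** Coherence forces the axioms by Dutch books.  In a coherent system a
    portfolio whose balance is everywhere at most [c] has [c >= 0]
    ([coherent_sup_ge0]).  Betting on or against one event gives
    [0 <= P A <= 1] and [P setT = 1]; the portfolios [(s, A), (s, B),
    (- s, A `|` B)] have a constant balance, and [s = 1] and [s = - 1] give
    finite additivity.  For disjoint [A_i] with union [U], finite additivity
    bounds the partial sums of the series of [P (A_i)], so the series has a sum
    [l]; then the stakes [- s] on [U] and [s] on every [A_i] form a portfolio of
    the system with constant balance [s * (P U - l)], whence [P U = l].

    Conversely, suppose that [P] is a countably additive probability and that
    some portfolio of the system has balance at most [- eps] everywhere.
    Extending [P] to the generated sigma-algebra and applying dominated
    convergence would contradict this, as every finite partial balance has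
    expectation 0.  The same argument can be carried out inside the field.
    Choose [N] such that the tail series of [`|a_i| * P (A_i)] from [N] on is
    at most [eps / 8], and put, for [s_N] the partial balance of the first [N]
    bets,
      [V_m = - (eps / 4) - s_N + \sum_(N <= i < N + m) `|a_i| * \1_(A_i)].
    The expectation of [V_m] is at most [- eps / 8].  On the other hand [V_m]
    is nondecreasing in [m], bounded below by some constant [- M], and at each
    point it is eventually nonnegative, because the partial balances eventually
    fall below [- eps / 2].  So the sets [0 <= V_m] increase to the whole
    space and their probabilities tend to 1
    ([prob_nondecreasing_cvg]).  But a Markov-type inequality
    ([simple_markov]) bounds the expectation of [V_m] below by
    [- M * P (V_m < 0)], which tends to 0: a contradiction.  The expectation
    of a finite combination of indicators is the same combination of
    probabilities; its monotonicity is [simple_ge0]. *)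

Set Implicit Arguments.
Unset Strict Implicit.
Unset Printing Implicit Defensive.

Import Order.TTheory GRing.Theory Num.Theory.
Import numFieldNormedType.Exports.

Local Open Scope classical_set_scope.
Local Open Scope ring_scope.

(** * Fields of sets *)

Section Fields.
Variables (Omega : Type) (C : set (set Omega)).
Hypothesis hC : field_of_sets C.

Lemma fieldT : C setT. Proof. by case: hC. Qed.

Lemma fieldC A : C A -> C (~` A). Proof. by case: hC => _ + _; apply. Qed.

Lemma fieldU A B : C A -> C B -> C (A `|` B).
Proof. by case: hC => _ _; apply. Qed.

Lemma field0 : C set0. Proof. by rewrite -setCT; exact/fieldC/fieldT. Qed.

Lemma fieldI A B : C A -> C B -> C (A `&` B).
Proof.
move=> CA CB; rewrite -(setCK (A `&` B)) setCI.
by apply/fieldC/fieldU; exact/fieldC.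
Qed.

Lemma fieldD A B : C A -> C B -> C (A `\` B).
Proof. by move=> CA CB; rewrite setDE; exact/fieldI/fieldC. Qed.

Lemma field_bigsetU (A : (set Omega) ^nat) n :
  (forall i, C (A i)) -> C (\big[setU/set0]_(i < n) A i).
Proof. by move=> CA; apply: big_ind => //; [exact: field0|exact: fieldU]. Qed.

(** Splitting on the first event turns its term into a constant, so the
    superlevel set is glued from two superlevel sets of the shorter sum; this
    is why the constant [c] is kept apart. *)
Lemma field_superlevel (R : realType) (I : Type) (r : seq I) (a : I -> R)
    (A : I -> set Omega) (c : R) : (forall i, C (A i)) ->
  C [set w | 0 <= c + \sum_(i <- r) a i * \1_(A i) w].
Proof.
move=> CA; elim: r c => [|i r IH] c.
  have [c0|c0] := leP 0 c.
    rewrite (_ : [set w | _] = setT); first exact: fieldT.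
    by apply/seteqP; split => w //= _; rewrite big_nil addr0.
  rewrite (_ : [set w | _] = set0); first exact: field0.
  by apply/seteqP; split => w //=; rewrite big_nil addr0 leNgt c0.
rewrite (_ : [set w | _] =
    (A i `&` [set w | 0 <= c + a i + \sum_(j <- r) a j * \1_(A j) w]) `|`
    (~` A i `&` [set w | 0 <= c + \sum_(j <- r) a j * \1_(A j) w])).
  by apply: fieldU; apply: fieldI => //; exact: fieldC.
apply/seteqP; split => w /=; rewrite big_cons indicE.
  have [Aw|Aw] := pselect (A i w).
    by rewrite mem_set // mulr1 addrA; left.
  by rewrite memNset // mulr0 add0r; right.
case=> [[Aw]|[Aw]]; first by rewrite mem_set // mulr1 addrA.
by rewrite memNset // mulr0 add0r.
Qed.

End Fields.

(** * Expectation of finite combinations of indicators *)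

Section Additive.
Variables (R : realType) (Omega : Type) (C : set (set Omega)).
Variable P : set Omega -> R.
Hypothesis hC : field_of_sets C.
Hypothesis hP : finitely_additive_probability C P.

Lemma prob_ge0 A : C A -> 0 <= P A.
Proof. by case: hP => + _ _ => /[apply] /andP[]. Qed.

Lemma prob_le1 A : C A -> P A <= 1.
Proof. by case: hP => + _ _ => /[apply] /andP[]. Qed.

Lemma probT : P setT = 1. Proof. by case: hP. Qed.

Lemma probU A B : C A -> C B -> A `&` B = set0 -> P (A `|` B) = P A + P B.
Proof. by case: hP => _ _; apply. Qed.

Lemma prob0 : P set0 = 0.
Proof.
have C0 := field0 hC.
by have := probU C0 C0 (set0I _); rewrite setU0; lra.
Qed.

Lemma probC A : C A -> P (~` A) = 1 - P A.
Proof.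
move=> CA; have := probU CA (fieldC hC CA) (setICr _).
by rewrite setUCr probT; lra.
Qed.

Lemma prob_split A B : C A -> C B -> P A = P (B `&` A) + P (~` B `&` A).
Proof.
move=> CA CB; rewrite -probU; last by rewrite setIACA setICr set0I.
- by rewrite -setIUl setUCr setTI.
- exact: (fieldI hC).
- by apply: (fieldI hC) => //; exact: (fieldC hC).
Qed.

Lemma prob_series (A : (set Omega) ^nat) n :
  (forall i, C (A i)) -> trivIset setT A ->
  series (P \o A) n = P (\big[setU/set0]_(i < n) A i).
Proof.
move=> CA tA; elim: n => [|n IH].
  by rewrite big_ord0 prob0 /series /= big_geq.
rewrite seriesSr IH big_ord_recr /= probU //; first exact: (field_bigsetU hC).
rewrite -subset0 => w; rewrite -bigcup_mkord /= => -[[i /= ltin Aiw] Anw].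
have := tA i n I I (ex_intro _ w (conj Aiw Anw)).
by move=> ein; rewrite ein ltnn in ltin.
Qed.

(** Positivity of the expectation without a canonical form of simple functions.
    The induction splits the domain [D] along the first event [A i]: on each
    half [\1_(A i)] is constant and is absorbed into [c].  This requires both [c] and
    [D] to vary. *)
Lemma simple_ge0 (I : Type) (r : seq I) (a : I -> R) (A : I -> set Omega) :
  (forall i, C (A i)) -> forall c D, C D ->
  (forall w, D w -> 0 <= c + \sum_(i <- r) a i * \1_(A i) w) ->
  0 <= c * P D + \sum_(i <- r) a i * P (A i `&` D).
Proof.
move=> CA; elim: r => [|i r IH] c D CD cD.
  rewrite big_nil addr0; have [D0|/set0P[w Dw]] := eqVneq D set0.
    by rewrite D0 prob0 mulr0.
  by have := cD w Dw; rewrite big_nil addr0 => c0; rewrite mulr_ge0// prob_ge0.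
have CAD : C (A i `&` D) by exact: (fieldI hC).
have CAD' : C (~` A i `&` D) by apply: (fieldI hC) => //; exact: (fieldC hC).
have /(IH (c + a i) _ CAD) h1 : forall w, (A i `&` D) w ->
    0 <= c + a i + \sum_(j <- r) a j * \1_(A j) w.
  by move=> w [Aw /cD]; rewrite big_cons indicE mem_set // mulr1 addrA.
have /(IH c _ CAD') h2 : forall w, (~` A i `&` D) w ->
    0 <= c + \sum_(j <- r) a j * \1_(A j) w.
  by move=> w [Aw /cD]; rewrite big_cons indicE memNset // mulr0 add0r.
rewrite big_cons (prob_split CD (CA i)).
have -> : \sum_(j <- r) a j * P (A j `&` D) =
    \sum_(j <- r) a j * P (A j `&` (A i `&` D)) +
    \sum_(j <- r) a j * P (A j `&` (~` A i `&` D)).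
  rewrite -big_split /=; apply: eq_bigr => j _; rewrite -mulrDr; congr (_ * _).
  by rewrite [LHS](prob_split _ (CA i)) ?(setICA (A j))//; exact: (fieldI hC).
by lra.
Qed.

(** With [V] the combination and [B] the event [0 <= V], the function
    [V + M * \1_(~` B)] is nonnegative everywhere: on [B] because [V] is, off
    [B] because [V >= - M].  So its expectation is nonnegative. *)
Lemma simple_markov (I : Type) (r : seq I) (a : I -> R) (A : I -> set Omega)
    (c M : R) : (forall i, C (A i)) ->
  (forall w, - M <= c + \sum_(i <- r) a i * \1_(A i) w) ->
  0 <= c + \sum_(i <- r) a i * P (A i) +
    M * (1 - P [set w | 0 <= c + \sum_(i <- r) a i * \1_(A i) w]).
Proof.
move=> CA hM; set B := [set w | _].
have CB : C B by exact: (field_superlevel hC).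
rewrite -probC //.
have := @simple_ge0 (option I) (None :: [seq Some i | i <- r]) (oapp a M)
  (oapp A (~` B)) _ c setT (fieldT hC).
rewrite big_cons big_map /= probT mulr1 setIT.
under [X in _ -> _ -> 0 <= _ + (_ + X)]eq_bigr do rewrite setIT.
rewrite (addrC (M * _)) addrA; apply.
  by case=> [i|] //=; exact: (fieldC hC).
move=> w _; rewrite big_cons big_map /= indicE addrCA.
have [Bw|Bw] := pselect (B w).
  by rewrite memNset ?mulr0 ?add0r //; exact.
by rewrite mem_set // mulr1; have := hM w; lra.
Qed.

End Additive.

(** * Continuity from below on the field *)

Lemma prob_nondecreasing_cvg (R : realType) (Omega : Type)
    (C : set (set Omega)) (P : set Omega -> R) (B : (set Omega) ^nat) :
  field_of_sets C -> countably_additive_probability C P ->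
  (forall n, C (B n)) -> nondecreasing_seq B -> \bigcup_n B n = setT ->
  P \o B @ \oo --> (1 : R).
Proof.
move=> hC [hP ca] CB ndB BT.
have CD i : C (seqD B i) by case: i => [|i] /=; [|exact: (fieldD hC)].
have -> : P \o B = [sequence series (P \o seqD B) n.+1]_n.
  apply/funext => n /=.
  rewrite (prob_series hC hP) ?nondecreasing_bigsetU_seqD //.
  exact: trivIset_seqD.
have := ca _ CD (trivIset_seqD ndB).
by rewrite eq_bigcup_seqD BT (probT hP) cvg_shiftS; apply; exact: (fieldT hC).
Qed.

(** * From countable additivity to coherence *)

Lemma series_small_tail (R : realType) (u : R ^nat) (d : R) :
  (forall i, 0 <= u i) -> cvgn (series u) -> 0 < d ->
  exists N, forall m, (N <= m)%N -> \sum_(N <= i < m) u i <= d.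
Proof.
move=> u0 cu d0.
have nd : {homo series u : n m / (n <= m)%N >-> n <= m}.
  by apply: nondecreasing_series => n _ _.
have [N _ hN] := cvgr_dist_lt _ _ cu _ d0.
exists N => m Nm; rewrite -sub_series_geq //.
have := hN N (leqnn N); rewrite ltr_norml => /andP[_].
by have := nondecreasing_cvgn_le nd cu m; rewrite /=; lra.
Qed.

Section Sufficiency.
Variables (R : realType) (Omega : Type) (C : set (set Omega)).
Variable P : set Omega -> R.
Hypothesis hC : field_of_sets C.

(** Dominated convergence carried out on the field: the indicators weighted by
    the absolute stakes dominate the tail of the balance, at a price of at most
    [eps / 8]. *)
Lemma countably_additive_coherent :
  countably_additive_probability C P -> system2_coherent C P.
Proof.
move=> hca; have hP := hca.1.
move=> [b [eps [[Cb cprice cbal] eps0 neg]]].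
pose a i := (b i).1; pose A i := (b i).2.
have p0 i : 0 <= P (A i) by apply: (prob_ge0 hP); exact: Cb.
have [N hN] : exists N, forall m, (N <= m)%N ->
    \sum_(N <= i < m) `|a i| * P (A i) <= eps / 8.
  by apply: series_small_tail => //; [move=> i; rewrite mulr_ge0|lra].
(* [V m] is the negated partial balance of the first [N] bets, plus the
   dominating tail, minus [eps / 4]; [d] and [c] put it in the form of a single
   combination of indicators plus a constant. *)
pose d i := if (i < N)%N then - a i else `|a i|.
pose c := - (eps / 4) + \sum_(0 <= i < N) a i * P (A i).
pose V m w := c + \sum_(0 <= i < N + m) d i * \1_(A i) w.
pose B m := [set w | 0 <= V m w].
have dE (x : nat -> R) m : \sum_(0 <= i < N + m) d i * x i =
    - \sum_(0 <= i < N) a i * x i + \sum_(N <= i < N + m) `|a i| * x i.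
  rewrite (@big_cat_nat _ _ _ N) ?leq_addr //= -sumrN; congr (_ + _).
    by apply: eq_big_nat => i /= iN; rewrite /d iN mulNr.
  by apply: eq_big_nat => i /andP[Ni _]; rewrite /d ltnNge Ni.
have CB m : C (B m) by exact: (field_superlevel hC).
have ndB : nondecreasing_seq B.
  apply/nondecreasing_seqP => m; apply/subsetPset => w.
  rewrite /B /V /= addnS big_nat_recr //= => /le_trans; apply.
  by rewrite /d ltnNge leq_addr /= addrA lerDl mulr_ge0.
(* The partial balance of [N + m] bets is eventually below [- eps / 2], and its
   negation is at most [V m + eps / 4 + eps / 8], the last term being the price
   of the tail; so [V m > 0] for large [m]. *)
have BT : \bigcup_m B m = setT.
  apply/seteqP; split => // w _.
  have bneg : limn (series (balance_term P b w)) < - (eps / 2).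
    by apply: le_lt_trans (neg w) _; lra.
  have [m _ hm] := cvgr_lt _ (cbal w) _ bneg.
  exists m => //; have /= := hm (N + m)%N (leq_addl _ _).
  rewrite /B /V /= dE /series /=.
  rewrite (@big_cat_nat _ _ _ N) ?leq_addr //=.
  rewrite /balance_term -/(a _) -/(A _).
  have -> : \sum_(0 <= i < N) (b i).1 * (\1_(b i).2 w - P (b i).2) =
      \sum_(0 <= i < N) a i * \1_(A i) w - \sum_(0 <= i < N) a i * P (A i).
    by rewrite -sumrB; apply: eq_bigr => i _; rewrite mulrBr.
  have : 0 <= \sum_(N <= i < N + m) `|a i| * \1_(A i) w +
      \sum_(N <= i < N + m) (b i).1 * (\1_(b i).2 w - P (b i).2) +
      \sum_(N <= i < N + m) `|a i| * P (A i).
    rewrite -!big_split /=; apply: sumr_ge0 => i _; rewrite -/(a i) -/(A i).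
    (* The summand is [(`|a| + a) * \1_A + (`|a| - a) * P A]. *)
    have i0 : 0 <= \1_(A i) w :> R by [].
    have := mulr_ge0 i0 (_ : 0 <= `|a i| + a i).
    have := mulr_ge0 (p0 i) (_ : 0 <= `|a i| - a i).
    have := ler_norm (a i); have := ler_norm (- a i); rewrite normrN.
    by move=> h1 h2 /(_ ltac:(lra)) h3 /(_ ltac:(lra)) h4; lra.
  by have := hN (N + m)%N (leq_addr _ _); rewrite /c; lra.
pose M := `|c| + \sum_(0 <= i < N) `|a i|.
have VM m w : - M <= V m w.
  rewrite /V dE.
  have : 0 <= \sum_(N <= i < N + m) `|a i| * \1_(A i) w.
    by apply: sumr_ge0 => i _; rewrite mulr_ge0.
  have : \sum_(0 <= i < N) a i * \1_(A i) w <= \sum_(0 <= i < N) `|a i|.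
    apply: ler_sum => i _; rewrite indicE.
    by case: (_ \in _); rewrite ?mulr1 ?mulr0 ?ler_norm.
  have := ler_norm (- c); rewrite normrN /M; lra.
(* Under the expectation the first [N] bets cancel their prices, which leaves
   [- eps / 4] plus a tail of at most [eps / 8]. *)
have key m : eps / 8 <= M * (1 - P (B m)).
  have := simple_markov (c := c) (M := M) hC hP (r := index_iota 0 (N + m))
    (a := d) (A := A) Cb (VM m).
  rewrite -/(V m) (dE (P \o A)) -/(B m) /= /c.
  by have := hN (N + m)%N (leq_addr _ _); lra.
have : M * (1 - P (B m)) @[m --> \oo] --> M * (1 - 1).
  apply: cvgMr; apply: cvgB; first exact: cvg_cst.
  exact: (prob_nondecreasing_cvg hC hca CB ndB BT).
move=> /cvgr_to_ge /(_ (nearW _ key)); rewrite subrr mulr0; lra.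
Qed.

End Sufficiency.

(** * Dutch books: from coherence to countable additivity *)

Section Necessity.
Variables (R : realType) (Omega : Type) (C : set (set Omega)).
Variable P : set Omega -> R.
Hypothesis hC : field_of_sets C.
Hypothesis coh : system2_coherent C P.

(** All Dutch books below go through this form: with [c < 0] the portfolio would
    lose at least [- c] everywhere. *)
Lemma coherent_sup_ge0 (b : bets R Omega) (f : Omega -> R) (c : R) :
  betting_portfolio C b ->
  cvgn (series (fun i => `|(b i).1| * P (b i).2)) ->
  (forall w, series (balance_term P b w) @ \oo --> f w) ->
  (forall w, f w <= c) -> 0 <= c.
Proof.
move=> Cb cb bf fc; rewrite leNgt; apply/negP => c0; apply: coh.
exists b, (- c); split; [|by rewrite oppr_gt0|].
  by split=> // w; apply/cvg_ex; exists (f w).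
by move=> w; rewrite /balance opprK (cvg_lim (@Rhausdorff R) (bf w)).
Qed.

Lemma series_nth_cvg (T : Type) (x0 : T) (s : seq T) (F : T -> R) : F x0 = 0 ->
  series (fun i => F (nth x0 s i)) @ \oo --> \sum_(x <- s) F x.
Proof.
move=> F0; apply: cvg_near_cst; exists (size s) => // n /= sn.
rewrite (big_nth x0) /series /= (@big_cat_nat _ _ _ (size s)) //=.
rewrite [X in _ + X]big_nat_cond [X in _ + X]big1 ?addr0 // => i.
by rewrite andbT => /andP[si _]; rewrite nth_default.
Qed.


(** A finite list of bets is a portfolio once padded with zero stakes on the
    event [setT], which contribute nothing to either series. *)
Lemma coherent_finite_sup_ge0 (s : seq (R * set Omega)) (c : R) :
  (forall i, C (nth (0, setT) s i).2) ->
  (forall w, \sum_(x <- s) x.1 * (\1_(x.2) w - P x.2) <= c) -> 0 <= c.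
Proof.
move=> Cs; apply: (coherent_sup_ge0 (b := nth (0, setT) s)) => //.
  apply/cvg_ex; eexists.
  apply: (@series_nth_cvg _ _ s (fun x => `|x.1| * P x.2)).
  by rewrite normr0 mul0r.
move=> w.
apply: (@series_nth_cvg _ _ s (fun x => x.1 * (\1_(x.2) w - P x.2))).
by rewrite mul0r.
Qed.

Lemma coherent_finitely_additive : finitely_additive_probability C P.
Proof.
have CT := fieldT hC.
have ind01 (A : set Omega) w : 0 <= (\1_A w : R) <= 1.
  by rewrite indicE; case: (_ \in _); rewrite !lexx ?ler01.
have le1 A : C A -> P A <= 1.
  move=> CA; rewrite -subr_ge0; apply: (@coherent_finite_sup_ge0 [:: (1, A)]).
    by case=> [|[|i]].
  by move=> w; rewrite big_seq1 /=; have := ind01 A w; lra.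
split.
- move=> A CA; rewrite le1 // andbT.
  apply: (@coherent_finite_sup_ge0 [:: (-1, A)]); first by case=> [|[|i]].
  by move=> w; rewrite big_seq1 /=; have := ind01 A w; lra.
- apply/eqP; rewrite eq_le le1 //= -subr_ge0.
  apply: (@coherent_finite_sup_ge0 [:: (-1, setT)]); first by case=> [|[|i]].
  by move=> w; rewrite big_seq1 /= indicT /=; lra.
- move=> A B CA CB AB; have CAB := fieldU hC CA CB.
  have indU w : \1_(A `|` B) w = \1_A w + \1_B w :> R.
    have ABw : ~ (A w /\ B w) by move=> ABw; have : set0 w by rewrite -AB.
    rewrite !indicE in_setU; have [Aw|Aw] := boolP (w \in A);
      last by rewrite add0r.
    rewrite (memNset (A := B)) ?addr0 // => Bw.
    by apply: ABw; split=> //; exact: set_mem.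
  (* The indicators cancel, so the balance is constant; [s] ranges over both
     signs to turn the inequality into an equality. *)
  have book (s : R) : 0 <= s * (P (A `|` B) - P A - P B).
    apply: (@coherent_finite_sup_ge0 [:: (s, A); (s, B); (- s, A `|` B)]).
      by case=> [|[|[|i]]] //=; rewrite nth_nil.
    by move=> w; rewrite !big_cons big_nil /= indU; lra.
  by have := book 1; have := book (-1); lra.
Qed.

Lemma series_indic_bigcup (A : (set Omega) ^nat) w : trivIset setT A ->
  series (fun i => \1_(A i) w : R) @ \oo --> (\1_(\bigcup_i A i) w : R).
Proof.
move=> tA; have [[k _ Akw]|nA] := pselect ((\bigcup_i A i) w).
  rewrite indicE mem_set; last by exists k.
  apply: cvg_near_cst; exists k.+1 => // n /= kn.
  rewrite /series /= big_mkord (bigD1 (Ordinal kn)) //= indicE mem_set //.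
  rewrite big1 ?addr0 //.
  move=> i ik; rewrite indicE memNset // => Aiw.
  by move/eqP: ik; apply; apply/val_inj/(tA _ _ I I); exists w.
rewrite indicE memNset //; apply: cvg_near_cst; apply: nearW => n.
rewrite /series /= big1 // => i _; rewrite indicE memNset // => Aiw.
by apply: nA; exists i.
Qed.

Lemma coherent_countably_additive : countably_additive_probability C P.
Proof.
have hP := coherent_finitely_additive; split => // A CA tA CU.
have cA : cvgn (series (P \o A)).
  apply: nondecreasing_is_cvgn.
    by apply: nondecreasing_series => n _ _; exact: (prob_ge0 hP).
  exists 1 => _ [n _ <-]; rewrite (prob_series hC hP) //.
  by apply: (prob_le1 hP); exact: (field_bigsetU hC).
set U := \bigcup_i A i in CU *.
set l := limn (series (P \o A)) in cA.
(* Pointwise, the indicators of the [A i] sum to that of [U], so the balance of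
   the portfolio below is the constant [s * (P U - l)]. *)
have book (s : R) : 0 <= s * (P U - l).
  pose b : bets R Omega := fun i => if i is j.+1 then (s, A j) else (- s, U).
  have seriesb (F : R * set Omega -> R) n :
      series (F \o b) n.+1 = F (- s, U) + series (fun i => F (s, A i)) n.
    by rewrite /series /= big_nat_recl.
  apply: (coherent_sup_ge0 (b := b) (f := fun=> s * (P U - l))) => //.
  - by case.
  - apply/cvg_ex; exists (`|- s| * P U + `|s| * l).
    rewrite -cvg_shiftS /=.
    under eq_fun do rewrite (seriesb (fun x => `|x.1| * P x.2)).
    apply: cvgD; first exact: cvg_cst.
    rewrite (_ : series _ = fun n => `|s| * series (P \o A) n).
      exact: cvgMr.
    by apply/funext => n; rewrite /series /= mulr_sumr.
  - move=> w; rewrite -cvg_shiftS /=.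
    under eq_fun do rewrite (seriesb (fun x => x.1 * (\1_(x.2) w - P x.2))).
    rewrite (_ : s * _ = - s * (\1_U w - P U) + s * (\1_U w - l)); last by ring.
    apply: cvgD; first exact: cvg_cst.
    rewrite (_ : series _ = fun n =>
        s * (series (fun i => \1_(A i) w : R) n - series (P \o A) n)).
      by apply: cvgMr; apply: cvgB => //; exact: series_indic_bigcup.
    by apply/funext => n; rewrite /series /= -sumrB mulr_sumr.
suff -> : P U = l by [].
by have := book 1; have := book (-1); lra.
Qed.

End Necessity.

Theorem theorem1 (R : realType) (Omega : Type) (C : set (set Omega))
    (P : set Omega -> R) (hC : field_of_sets C) :
  system2_coherent C P <-> countably_additive_probability C P.
Proof.
split; first exact: coherent_countably_additive.
exact: countably_additive_coherent.
Qed.
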